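(* There is a constant $c=c(d)>0$, depending only on $d$, such that the following hold for every convex body $C\subset\mathbb{R}^d$. (i) For every positive integer $k$ and every finite non-$\frac{k}{2}/C$-degenerate set $S\subset\mathbb{R}^d$ with $|S|\ge k$, we have $g(C,k,S)\ge c\,\frac{|S|}{k}$. (ii) For every real $k>0$ and every $C$-nice measure $\mu$ with $\mu(\mathbb{R}^d)> k$, we have $g(C,k,\mu)\ge c\,\frac{\mu(\mathbb{R}^d)}{k}$.
   Context: A convex body is a convex compact set with nonempty interior. A homothet of $C$ is a set $\lambda C+x$ with $x\in\mathbb{R}^d$, $\lambda>0$. A set $S$ is non-$t/C$-degenerate if the boundary of every homothet of $C$ contains at most $t$ points of $S$. Measures are Borel measures on $\mathbb{R}^d$ finite on compact sets; $\mu$ is non-$C$-degenerate if it vanishes on the boundary of every homothet of $C$, and $C$-nice if it is finite, non-$C$-degenerate, and there is a ball $K$ with $\mu(K)=\mu(\mathbb{R}^d)$. A $k^+/S$-homothet is a homothet of $C$ containing at least $k$ points of $S$; a $k^+/\mu$-homothet is a homothet of $C$ with $\mu$-measure at least $k$. $g(C,k,S)$ (resp. $g(C,k,\mu)$) is the maximum number of pairwise interior-disjoint $k^+/S$-homothets (resp. $k^+/\mu$-homothets) of $C$. *)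

(* Defs.v *)
From HB Require Import structures.
From mathcomp Require Import all_boot all_order all_algebra finmap.
From mathcomp Require Import all_classical all_reals all_analysis.
Set Implicit Arguments. Unset Strict Implicit. Unset Printing Implicit Defensive.
Import Order.TTheory GRing.Theory Num.Theory.
Import numFieldNormedType.Exports.
Local Open Scope classical_set_scope.
Local Open Scope ring_scope.


(* Points of R^d are row vectors 'rV[R]_d (topology = product topology,
   which is the Euclidean topology). *)

Notation BorelRd R d := (g_sigma_algebraType (@open 'rV[R%type]_d)).

Definition convex_body (R : realType) (d : nat) (C : set 'rV[R]_d) :=
  (forall x y (t : R), C x -> C y -> 0 <= t -> t <= 1 ->
     C (t *: x + (1 - t) *: y)) /\
  compact C /\ interior C !=set0.

Definition homothet (R : realType) (d : nat) (C : set 'rV[R]_d) (l : R)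
    (x : 'rV[R]_d) : set 'rV[R]_d :=
  [set l *: y + x | y in C].

Definition bdry (R : realType) (d : nat) (A : set 'rV[R]_d) :=
  closure A `\` interior A.

Definition is_homothet (R : realType) (d : nat) (C H : set 'rV[R]_d) :=
  exists l x, 0 < l /\ H = homothet C l x.

Definition npts (R : realType) (d : nat) (S : {fset 'rV[R]_d})
    (A : set 'rV[R]_d) : nat :=
  #|` [fset p in S | p \in A]%fset |.

Definition non_degenerate (R : realType) (d : nat) (t : R)
    (C : set 'rV[R]_d) (S : {fset 'rV[R]_d}) :=
  forall H, is_homothet C H -> (npts S (bdry H))%:R <= t.

Definition eball (R : realType) (d : nat) (c : 'rV[R]_d) (r : R)
    : set 'rV[R]_d :=
  [set y | \sum_(i < d) (y ord0 i - c ord0 i) ^+ 2 <= r ^+ 2].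

Definition C_nice (R : realType) (d : nat) (C : set 'rV[R]_d)
    (mu : {measure set (BorelRd R d) -> \bar R}) :=
  (mu setT < +oo)%E /\
  (forall H, is_homothet C H -> mu (bdry H) = 0%E) /\
  (exists c r, mu (eball c r) = mu setT).

Definition kplus_pts (R : realType) (d : nat) (C : set 'rV[R]_d) (k : nat)
    (S : {fset 'rV[R]_d}) (H : set 'rV[R]_d) :=
  is_homothet C H /\ (k <= npts S H)%N.

Definition kplus_mu (R : realType) (d : nat) (C : set 'rV[R]_d) (k : R)
    (mu : {measure set (BorelRd R d) -> \bar R}) (H : set 'rV[R]_d) :=
  is_homothet C H /\ (k%:E <= mu H)%E.

Definition packing (R : realType) (d : nat) (P : set 'rV[R]_d -> Prop)
    (n : nat) :=
  exists F : 'I_n -> set 'rV[R]_d,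
    (forall i, P (F i)) /\
    (forall i j, i != j -> interior (F i) `&` interior (F j) = set0).

(* g(C, k, .) >= r, where g is the maximum size of such a packing *)
Definition g_ge (R : realType) (d : nat) (P : set 'rV[R]_d -> Prop) (r : R) :=
  exists n, packing P n /\ r <= n%:R.

(* Main.v *)
Require Import Defs.
From HB Require Import structures.
From mathcomp Require Import all_boot all_order all_algebra finmap.
From mathcomp Require Import all_classical all_reals all_analysis.
From mathcomp Require Import ring lra zify.
Set Implicit Arguments. Unset Strict Implicit. Unset Printing Implicit Defensive.
Import Order.TTheory GRing.Theory Num.Theory.
Import numFieldNormedType.Exports.
Local Open Scope classical_set_scope.
Local Open Scope ring_scope.

(* A maximal greedy packing F_1, ..., F_m by homothets that are good (weight at
   least k), each of nearly smallest ratio among those disjoint from its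
   predecessors, comes with a set P of O(m) points meeting every good homothet:
   a good homothet meets some F_i of at most twice its ratio, hence contains a
   point of a finite net around F_i. On the other hand the relevant bounded
   region is covered by O(|P|) homothets that avoid P, up to tiny ones around the
   points of P; none of these is good or they are tiny, so the total weight is
   O(m k).
   For the cover, regard the points as small disjoint balls. A ball that is
   isolated up to a larger scale is surrounded by an annulus, covered by O(1)
   long homothets whose boundaries pass next to the ball; once the scale reaches
   the smallest distance r between two balls, what remains near them is covered
   by O(1) homothets of size about r, and the balls within distance 2r are merged
   into one. Each merging costs O(1) and decreases the number of balls.
   The constants depend on d only because an affine image of C lies between the
   unit cube and its dilation by 4d + 1: take a simplex in C of at least half the
   largest possible volume. *)

(** * Nets of the unit ball and covers by homothets *)

Lemma row_norm_le (R : realType) (d : nat) (x : 'rV[R]_d) (e : R) : 0 <= e ->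
  (forall i, `|x ord0 i| <= e) -> `|x| <= e.
Proof.
move=> e0 xe; rewrite [leLHS]/Num.norm /= mx_normrE.
by apply/bigmax_leP; split => // -[i j] _ /=; rewrite ord1.
Qed.

Lemma row_norm_ge (R : realType) (d : nat) (x : 'rV[R]_d) i :
  `|x ord0 i| <= `|x|.
Proof.
rewrite [leRHS]/Num.norm /= mx_normrE.
by apply/bigmax_geP; right; exists (ord0, i).
Qed.

Lemma homothetP (R : realType) (d : nat) (C : set 'rV[R]_d) (l : R)
    (a z : 'rV[R]_d) : 0 < l -> homothet C l a z <-> C (l^-1 *: (z - a)).
Proof.
move=> l0; split.
  by move=> [y Cy <-]; rewrite addrK scalerA mulVf ?lt0r_neq0 // scale1r.
move=> Cz; exists (l^-1 *: (z - a)) => //.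
by rewrite scalerA mulfV ?lt0r_neq0 // scale1r subrK.
Qed.

Lemma norm_le_compact (R : realType) (d : nat) (B : R) : (0 < d)%N ->
  compact [set x : 'rV[R]_d | `|x| <= B].
Proof.
case: d => // d _; apply: bounded_closed_compact.
  exists B; split; first exact: num_real.
  by move=> M BM x /= xB; exact: le_trans xB (ltW BM).
rewrite (_ : mkset _ = (fun x : 'rV[R]_d.+1 => `|x|) @^-1` [set t | t <= B]) //.
by apply: closed_comp; [move=> x _; exact: norm_continuous|exact: closed_le].
Qed.

Definition ball_net (R : realType) (d : nat) (e : R) (G : seq 'rV[R]_d) :=
  (forall u, u \in G -> `|u| <= 1) /\
  forall v, `|v| <= 1 -> exists2 u, u \in G & `|v - u| <= e.

Lemma ball_net_exists (R : realType) (d : nat) (e : R) :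
  0 < e -> exists G : seq 'rV[R]_d, ball_net e G.
Proof.
case: d => [e0|d e0].
  exists [:: 0]; split=> [u|v _]; first by rewrite inE => /eqP ->; rewrite normr0.
  by exists 0; rewrite ?inE // (thinmx0 v) subr0 normr0 ltW.
pose A := [set x : 'rV[R]_d.+1 | `|x| <= 1].
have cA : compact A by exact: norm_le_compact.
move: cA; rewrite compact_cover => /(_ 'rV[R]_d.+1 A (fun c => ball c e)).
case.
- by move=> x _; exact: ball_open.
- by move=> x Ax; exists x => //; exact: ballxx.
move=> D' D'A AD'; exists (enum_fset D'); split.
  by move=> u uD; have := D'A _ uD; rewrite inE.
move=> v /AD' [u /= uD]; rewrite -ball_normE /= => uv.
by exists u => //; rewrite distrC ltW.
Qed.

Lemma ball_net_scaled (R : realType) (d : nat) (e r : R) (G : seq 'rV[R]_d)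
    (a x : 'rV[R]_d) : ball_net e G -> 0 < r -> `|x - a| <= r ->
  exists2 u, u \in G & `|x - (a + r *: u)| <= r * e.
Proof.
move=> [_ net] r0 xa; have [|u uG xu] := net (r^-1 *: (x - a)).
  by rewrite normrZ gtr0_norm ?invr_gt0 // mulrC ler_pdivrMr ?mul1r.
exists u => //.
have -> : x - (a + r *: u) = r *: (r^-1 *: (x - a) - u).
  by apply/rowP => i; rewrite !mxE; field; rewrite lt0r_neq0.
by rewrite normrZ gtr0_norm // ler_pM2l.
Qed.

(* A pair [(a, l)] stands for the homothet [l C + a]; [Q] restricts the
   homothets that may be used. *)
Definition hcover (R : realType) (d : nat) (C : set 'rV[R]_d)
    (Q : 'rV[R]_d * R -> Prop) (n : nat) (A : set 'rV[R]_d) :=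
  exists s : seq ('rV[R]_d * R), [/\ (size s <= n)%N,
    forall h, h \in s -> Q h &
    forall x, A x -> exists2 h, h \in s & homothet C h.2 h.1 x].

Lemma hcover_sub (R : realType) (d : nat) (C : set 'rV[R]_d)
    (Q Q' : 'rV[R]_d * R -> Prop) (n n' : nat) (A A' : set 'rV[R]_d) :
  (n <= n')%N -> (forall h, Q h -> Q' h) -> A' `<=` A ->
  hcover C Q n A -> hcover C Q' n' A'.
Proof.
move=> nn QQ AA [s [sn sQ sA]]; exists s; split; first exact: leq_trans nn.
  by move=> h /sQ/QQ.
by move=> x /AA/sA.
Qed.

Lemma hcover_set0 (R : realType) (d : nat) (C : set 'rV[R]_d)
    (Q : 'rV[R]_d * R -> Prop) (n : nat) (A : set 'rV[R]_d) :
  (forall x, ~ A x) -> hcover C Q n A.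
Proof. by move=> A0; exists [::]; split => // x /A0. Qed.

Lemma hcover1 (R : realType) (d : nat) (C : set 'rV[R]_d)
    (Q : 'rV[R]_d * R -> Prop) (A : set 'rV[R]_d) (a : 'rV[R]_d) (l : R) :
  Q (a, l) -> A `<=` homothet C l a -> hcover C Q 1 A.
Proof.
move=> Qal AC; exists [:: (a, l)]; split => //.
  by move=> h; rewrite inE => /eqP ->.
by move=> x /AC ?; exists (a, l); rewrite ?inE.
Qed.

Lemma hcoverU (R : realType) (d : nat) (C : set 'rV[R]_d)
    (Q : 'rV[R]_d * R -> Prop) (n m : nat) (A B : set 'rV[R]_d) :
  hcover C Q n A -> hcover C Q m B -> hcover C Q (n + m) (A `|` B).
Proof.
move=> [s [sn sQ sA]] [t [tm tQ tB]]; exists (s ++ t); split.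
- by rewrite size_cat leq_add.
- by move=> h; rewrite mem_cat => /orP[/sQ|/tQ].
- by move=> x [/sA|/tB] [h hs hx]; exists h; rewrite // mem_cat hs ?orbT.
Qed.

Lemma hcover_seq (R : realType) (d : nat) (C : set 'rV[R]_d)
    (Q : 'rV[R]_d * R -> Prop) (n : nat) (T : eqType) (G : seq T)
    (A : T -> set 'rV[R]_d) :
  (forall g, g \in G -> hcover C Q n (A g)) ->
  hcover C Q (size G * n) [set x | exists2 g, g \in G & A g x].
Proof.
elim: G => [_|g G IH GA]; first by apply: hcover_set0 => x [].
apply: (@hcover_sub _ _ _ Q Q (n + size G * n) _
  (A g `|` [set x | exists2 g, g \in G & A g x])) => //.
- move=> x [h]; rewrite inE => /predU1P[-> Agx|hG Ahx]; first by left.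
  by right; exists h.
apply: hcoverU; first by apply: GA; rewrite inE eqxx.
by apply: IH => h hG; apply: GA; rewrite inE hG orbT.
Qed.

(** * Covering an annulus *)

Definition segment_closed (R : realType) (d : nat) (C : set 'rV[R]_d) :=
  forall x y (t : R), C x -> C y -> 0 <= t -> t <= 1 ->
    C (t *: x + (1 - t) *: y).

(** The norm on row vectors is the maximum norm, so this sandwiches a convex set between the unit
    cube and its dilate by [K]. *)
Definition round_body (R : realType) (d : nat) (K : R) (C : set 'rV[R]_d) :=
  [/\ segment_closed C, forall y, `|y| <= 1 -> C y & forall y, C y -> `|y| <= K].

(** The supremum of the [t] with [- (t *: u)] in [C] may fail to be attained, as [C] is not assumed
    closed; hence the slack [e]. The bound [2 * K] comes from [2^-1 <= |u|]. *)
Lemma round_body_exit (R : realType) (d : nat) (K : R) (C : set 'rV[R]_d)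
    (u : 'rV[R]_d) (e : R) :
  round_body K C -> 2^-1 <= `|u| -> `|u| <= 1 -> 0 < e ->
  exists t, [/\ 1 <= t, t <= 2 * K, C (- (t *: u)) &
    forall t', t + e <= t' -> ~ C (- (t' *: u))].
Proof.
move=> rC u2 u1 e0; have [cC C1 CK] := rC.
pose S := [set t : R | C (- (t *: u))].
have S1 : S 1 by apply: C1; rewrite scale1r normrN.
have SK t : S t -> t <= 2 * K.
  move=> /CK; rewrite normrN normrZ => tK.
  case: (lerP t 0) => t0.
    have : 0 <= `|t| * `|u| by rewrite mulr_ge0.
    lra.
  move: tK; rewrite gtr0_norm //; nra.
have hS : has_sup S by split; [exists 1|exists (2 * K)].
have [t St te] := sup_adherent e0 hS.
have [t1|t1] := leP 1 t.
  exists t; split => //; first exact: SK.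
  move=> t' tt' St'; have := ub_le_sup (proj2 hS) St'; lra.
(* The supremum is below [t + e < 1 + e], so [1] itself works. *)
exists 1; split => //; first exact: SK.
move=> t' tt' St'; have := ub_le_sup (proj2 hS) St'; lra.
Qed.

(* The homothet is a long copy of [C] whose boundary passes near the small
   ball, on its [u]-side, and which contains a cone in the direction [u]. *)
Lemma cone_homothet (R : realType) (d : nat) (K : R) (C : set 'rV[R]_d)
    (p u : 'rV[R]_d) (r1 r2 : R) :
  round_body K C -> 1 <= K -> 0 < r1 -> r1 * (4 * K + 4) <= r2 ->
  2^-1 <= `|u| -> `|u| <= 1 ->
  exists a, (forall y, homothet C r2 a y ->
               r1 < `|y - p| /\ `|y - p| <= (3 * K + 1) * r2) /\
    forall x, r1 * (4 * K + 4) <= `|x - p| -> `|x - p| <= r2 ->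
      `| `|x - p|^-1 *: (x - p) - u| <= (4 * K)^-1 -> homothet C r2 a x.
Proof.
move=> rC K1 r10 r12 u2 u1; have [cC C1 CK] := rC.
have r20 : 0 < r2 by nra.
have e0 : 0 < r1 / r2 by rewrite divr_gt0.
have e1 : r1 / r2 <= 1 by rewrite ler_pdivrMr // mul1r; nra.
have [t [t1 tK Ct exit]] := round_body_exit rC u2 u1 e0.
have t0 : 0 < t by lra.
(* The centre is chosen so that the point [- (t *: u)] of [C] is sent to [p + s *: u]: the homothet
   begins at distance of order [s] from [p] and extends in direction [u]. *)
pose s := (2 * K + 2) * r1.
have s0 : 0 < s by rewrite /s; nra.
have ss : 2 * s <= r2 by rewrite /s; nra.
exists (p + s *: u + (r2 * t) *: u); split.
- move=> y yD; split; last first.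
    have [c Cc <-] := yD.
    have -> : r2 *: c + (p + s *: u + (r2 * t) *: u) - p =
        r2 *: c + s *: u + (r2 * t) *: u.
      by apply/rowP => i; rewrite !mxE; ring.
    apply: le_trans (ler_normD _ _) _.
    apply: le_trans (lerD (ler_normD _ _) (lexx _)) _.
    rewrite (normrZ r2 c) (normrZ s u) (normrZ (r2 * t) u) (gtr0_norm r20)
      (gtr0_norm s0) (gtr0_norm (mulr_gt0 r20 t0)).
    have := CK _ Cc.
    have h1 : s * `|u| <= s by nra.
    have h2 : r2 * t * `|u| <= r2 * t by apply: ler_piMr => //; nra.
    nra.
  rewrite ltNge; apply/negP => yr.
  move/(homothetP _ _ _ r20): yD => Cy.
  (* With this weight [y] cancels from the combination of [- (y - p) / r1], in the unit ball, and
     [(y - a) / r2], where [a] is the centre. What is left is a multiple of [- u] that lies past the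
     exit point, because [s] is at least [r1 * (t + 1 + r1 / r2)]. *)
  pose th := r1 / (r2 + r1).
  have th0 : 0 <= th by apply: divr_ge0; lra.
  have th1 : th <= 1 by rewrite ler_pdivrMr; lra.
  have Cw : C (- (r1^-1 *: (y - p))).
    apply: C1; rewrite normrN normrZ gtr0_norm ?invr_gt0 //.
    by rewrite mulrC ler_pdivrMr ?mul1r.
  have := cC _ _ _ Cw Cy th0 th1.
  have -> : th *: - (r1^-1 *: (y - p)) +
      (1 - th) *: (r2^-1 *: (y - (p + s *: u + (r2 * t) *: u))) =
      - (((r2 * t + s) / (r2 + r1)) *: u).
    apply/rowP => i; rewrite !mxE /th; field.
    by rewrite !lt0r_neq0 //=; lra.
  apply: exit; rewrite ler_pdivlMr; last by lra.
  rewrite mulrDl mulrDr.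
  have -> : r1 / r2 * (r2 + r1) = r1 + r1 / r2 * r1 by field; lra.
  rewrite /s; nra.
- move=> x xr1 xr2 xu; apply/homothetP => //.
  set z := `|x - p| in xr1 xr2 xu *.
  have z0 : 0 < z by nra.
  have zs : 2 * s <= z by rewrite /s; nra.
  (* The preimage of [x] in [C] is the combination, with weights [mu] and [1 - mu], of a multiple of
     the direction error of [x] and of [- (t *: u)]. The multiplier [z * t / (z - s)] is at most
     [4 * K], since [t <= 2 * K] and [2 * s <= z], so the first point is in the unit ball. *)
  pose mu := (z - s) / (r2 * t).
  have rt0 : 0 < r2 * t by nra.
  have mu0 : 0 <= mu by apply: divr_ge0; lra.
  have mu1 : mu <= 1 by rewrite ler_pdivrMr // mul1r; nra.
  have Cw : C ((z * t / (z - s)) *: (z^-1 *: (x - p) - u)).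
    apply: C1; rewrite normrZ.
    have h0 : 0 < z - s by lra.
    have h : 0 <= z * t / (z - s) by apply: divr_ge0; nra.
    have h2 : z * t / (z - s) <= 4 * K.
      by rewrite ler_pdivrMr //; nra.
    rewrite ger0_norm //; apply: le_trans (ler_pM h _ h2 xu) _ => //.
    by rewrite mulfV //; lra.
  have := cC _ _ _ Cw Ct mu0 mu1.
  congr (C _); apply/rowP => i; rewrite !mxE /mu; field.
  by rewrite !lt0r_neq0 //=; lra.
Qed.

(** Every direction from [p] is within [(4 * K)^-1] of some net vector, and one cone homothet per
    net vector suffices. *)
Lemma annulus_cover (R : realType) (d : nat) (K : R) (C : set 'rV[R]_d)
    (G : seq 'rV[R]_d) (p : 'rV[R]_d) (r1 r2 : R) :
  round_body K C -> 1 <= K ->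
  ball_net (4 * K)^-1 G -> 0 < r1 -> 0 < r2 ->
  hcover C (fun h => 0 < h.2 /\ forall y, homothet C h.2 h.1 y ->
               r1 < `|y - p| /\ `|y - p| <= (3 * K + 1) * r2)
    (size G) [set x | r1 * (4 * K + 4) <= `|x - p| /\ `|x - p| <= r2].
Proof.
move=> rC K1 [G1 Gnet] r10 r20.
have [r12|r12] := lerP (r1 * (4 * K + 4)) r2; last first.
  by apply: hcover_set0 => x [? ?]; lra.
have K4 : (4 * K)^-1 <= 2^-1 by rewrite lef_pV2 ?posrE; lra.
rewrite -[size G]muln1.
apply: (@hcover_sub _ _ _ _ _ _ _ [set x | exists2 u, u \in G &
  [/\ `| `|x - p|^-1 *: (x - p) - u| <= (4 * K)^-1,
      r1 * (4 * K + 4) <= `|x - p| & `|x - p| <= r2]]) (leqnn _) (fun h Q => Q) _ _.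
  move=> x [xr1 xr2]; have z0 : 0 < `|x - p| by nra.
  have [|u uG xu] := Gnet (`|x - p|^-1 *: (x - p)).
    by rewrite normrZ ger0_norm ?invr_ge0 // mulVf // lt0r_neq0.
  by exists u.
apply: hcover_seq => u uG.
(* A net vector shorter than [1/2] is too far from every unit vector to serve any [x]. *)
have [u2|u2] := lerP 2^-1 `|u|; last first.
  apply: hcover_set0 => x [xu xr1 _].
  have z0 : 0 < `|x - p| by nra.
  have v1 : `| `|x - p|^-1 *: (x - p)| = 1.
    by rewrite normrZ ger0_norm ?invr_ge0 // mulVf // lt0r_neq0.
  have := lerB_dist (`|x - p|^-1 *: (x - p)) u; rewrite v1; lra.
have [a [aD aC]] := cone_homothet p rC K1 r10 r12 u2 (G1 _ uG).
by apply: (@hcover1 _ _ _ _ _ a r2) => // x [? ? ?]; exact: aC.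
Qed.

(** * Covering the complement of finitely many balls *)

Lemma seq_argmin (R : realDomainType) (T : eqType) (f : T -> R) (s : seq T) (x : T) :
  x \in s -> exists2 y, y \in s & forall z, z \in s -> f y <= f z.
Proof.
elim: s x => [//|y [|z s] IH] x _.
  by exists y; rewrite ?inE // => z; rewrite inE => /eqP ->.
have [w ws wmin] := IH z (mem_head _ _).
have [yw|wy] := leP (f y) (f w).
  exists y; rewrite ?inE ?eqxx // => v; rewrite inE => /predU1P[->//|/wmin].
  exact: le_trans.
exists w; first by rewrite inE ws orbT.
by move=> v; rewrite inE => /predU1P[->|/wmin //]; exact: ltW.
Qed.

Lemma closest_pair (R : realType) (d : nat) (T : eqType) (f : T -> 'rV[R]_d)
    (s : seq T) (x y : T) :
  x \in s -> y \in s -> x != y ->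
  exists x' y', [/\ x' \in s, y' \in s, x' != y' &
    forall z w, z \in s -> w \in s -> z != w -> `|f x' - f y'| <= `|f z - f w|].
Proof.
move=> xs ys xy.
pose pairs := [seq q <- [seq (a, b) | a <- s, b <- s] | q.1 != q.2].
have inP a b : ((a, b) \in pairs) = [&& a != b, a \in s & b \in s].
  rewrite mem_filter /=; congr (_ && _); apply/allpairsP/andP.
    by move=> [[a' b'] /= [? ? [-> ->]]].
  by move=> [? ?]; exists (a, b).
have xyp : (x, y) \in pairs by rewrite inP xy xs ys.
have [[a b] abp abmin] := seq_argmin (fun q => `|f q.1 - f q.2|) xyp.
move: abp; rewrite inP => /and3P[ab sa sb]; exists a, b; split => // z w zs ws zw.
by apply: (abmin (z, w)); rewrite inP zw zs ws.
Qed.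

(* [o.1] and [o.2] are the centre and the radius of an obstacle [o]. *)
Definition obst_free (R : realType) (d : nat) (C : set 'rV[R]_d)
    (s : seq ('rV[R]_d * R)) (h : 'rV[R]_d * R) :=
  0 < h.2 /\ forall y, homothet C h.2 h.1 y -> forall o, o \in s -> o.2 < `|y - o.1|.

(** The region to cover stays outside the obstacles dilated by [a], while the covering homothets
    only have to avoid the obstacles themselves; this gap leaves room for the cover. *)
Definition obst_far (R : realType) (d : nat) (a B : R)
    (s : seq ('rV[R]_d * R)) : set 'rV[R]_d :=
  [set x | `|x| <= B /\ forall o, o \in s -> o.2 * a <= `|x - o.1|].

(* Only obstacles with no other obstacle within [2 * r] may have radius above
   [2 * r]; this survives the merging of all obstacles within [2 * r] of a
   given one into a single obstacle of radius [4 * r]. *)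
Definition obst_sep (R : realType) (d : nat) (r : R) (s : seq ('rV[R]_d * R)) :=
  forall o o', o \in s -> o' \in s -> o != o' ->
    r <= `|o.1 - o'.1| /\
    (o.2 <= 2 * r \/ (o.2 <= 4 * r /\ 2 * r <= `|o.1 - o'.1|)).

Lemma obst_sep_radius (R : realType) (d : nat) (r : R)
    (s : seq ('rV[R]_d * R)) o o' :
  obst_sep r s -> 0 <= r -> o \in s -> o' \in s -> o != o' ->
  o.2 <= 4 * r.
Proof. by move=> sep r0 os o's oo'; case: (sep o o') => // _ [|[]]; lra. Qed.

(** The radius bound [4 * r] of merged obstacles is at most [2 * r'], the ordinary bound at the new
    scale. *)
Lemma obst_sep_double (R : realType) (d : nat) (r r' : R)
    (s : seq ('rV[R]_d * R)) :
  obst_sep r s -> 0 <= r -> 2 * r <= r' ->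
  (forall o o', o \in s -> o' \in s -> o != o' -> r' <= `|o.1 - o'.1|) ->
  obst_sep r' s.
Proof.
move=> sep r0 rr dist o o' os o's oo'; split; first exact: dist.
by left; have := obst_sep_radius sep r0 os o's oo'; lra.
Qed.

Definition obst_merge (R : realType) (d : nat) (r : R) (s : seq ('rV[R]_d * R))
    (i : 'rV[R]_d * R) :=
  (i.1, 4 * r) :: [seq l <- s | 2 * r <= `|l.1 - i.1|].

Lemma obst_merge_sep (R : realType) (d : nat) (r : R) (s : seq ('rV[R]_d * R)) i :
  0 < r -> obst_sep r s -> i \in s -> obst_sep r (obst_merge r s i).
Proof.
move=> r0 sep si.
have far l : l \in s -> 2 * r <= `|l.1 - i.1| -> l.2 <= 4 * r.
  move=> ls li; apply: (obst_sep_radius sep (ltW r0) ls si).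
  by apply: contraTneq li => ->; rewrite subrr normr0 -ltNge; lra.
move=> o o'; rewrite !inE !mem_filter.
move=> /predU1P[->|/andP[fo os]] /predU1P[->|/andP[fo' os']] /= oo'.
- by rewrite eqxx in oo'.
- by rewrite distrC; split; [lra|right; lra].
- by split; [lra|right; split => //; exact: far].
- exact: sep.
Qed.

(** Both [i] and [j] are removed and only one obstacle is added. *)
Lemma obst_merge_size (R : realType) (d : nat) (r : R) (s : seq ('rV[R]_d * R)) i j :
  0 < r -> i \in s -> j \in s -> i != j -> `|i.1 - j.1| < 2 * r ->
  (size (obst_merge r s i) < size s)%N.
Proof.
move=> r0 si sj ij dij /=; rewrite size_filter.
pose P (l : 'rV[R]_d * R) := 2 * r <= `|l.1 - i.1|.
rewrite -[X in (_ < X)%N](count_predC P) -addn2 leq_add2l.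
rewrite -size_filter; set t := seq.filter _ _.
have : (size (undup [:: i; j]) <= size t)%N.
  apply: uniq_leq_size; first exact: undup_uniq.
  move=> l; rewrite mem_undup !inE mem_filter /= /P => /orP[/eqP ->|/eqP ->].
    by rewrite si andbT subrr normr0 -ltNge; lra.
  by rewrite sj andbT -ltNge distrC.
by rewrite undup_id //= inE ij.
Qed.

(** An absorbed obstacle has another one within distance [2 * r] (namely [i], or [j] for [i]
    itself), so [obst_sep] bounds its radius by [2 * r] and it lies in the new ball of radius
    [4 * r]. *)
Lemma obst_merge_free (R : realType) (d : nat) (C : set 'rV[R]_d) (r : R)
    (s : seq ('rV[R]_d * R)) i j h :
  0 < r -> obst_sep r s -> i \in s -> j \in s -> i != j ->
  `|i.1 - j.1| < 2 * r -> obst_free C (obst_merge r s i) h -> obst_free C s h.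
Proof.
move=> r0 sep si sj ij dij [h0 hs]; split=> // y hy o os.
have [far|near] := leP (2 * r) `|o.1 - i.1|.
  by apply: hs => //; rewrite inE mem_filter far os orbT.
have o2 : o.2 <= 2 * r.
  have [->|oi] := eqVneq o i; first by case: (sep i j) => // _ [|[]] //; lra.
  by case: (sep o i) => // _ [|[]] //; lra.
have := hs y hy (i.1, 4 * r) (mem_head _ _); rewrite /= => yi.
have := ler_distD o.1 y i.1; lra.
Qed.

(** The net [G2], scaled by [b * r], has mesh [r / 4]. Centres are at least [r] apart, so each net
    point serves at most one obstacle, and one annulus cover is spent on it. *)
Lemma obst_annuli_cover (R : realType) (d : nat) (K : R) (C : set 'rV[R]_d)
    (G1 G2 : seq 'rV[R]_d) (B r th b : R) (s : seq ('rV[R]_d * R)) (p : 'rV[R]_d) :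
  round_body K C -> 1 <= K -> ball_net (4 * K)^-1 G1 ->
  ball_net (4 * b)^-1 G2 -> 0 < r -> 0 < th -> th * (4 * (3 * K + 2)) = 1 -> 0 < b ->
  (forall o, o \in s -> 0 < o.2) -> obst_sep r s ->
  hcover C (obst_free C s) (size G2 * size G1)
    [set x | obst_far (4 * K + 4) B s x /\
       exists2 l, l \in s & `|l.1 - p| <= b * r /\ `|x - l.1| <= th * r].
Proof.
move=> rC K1 G1net G2net r0 th0 thE b0 s0 sep.
have br0 : 0 < b * r by rewrite mulr_gt0.
apply: (@hcover_sub _ _ _ (obst_free C s) _ _ _ [set x | exists2 g, g \in G2 &
   obst_far (4 * K + 4) B s x /\ exists2 l, l \in s &
     `|l.1 - (p + (b * r) *: g)| <= r / 4 /\ `|x - l.1| <= th * r]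
   _ (leqnn _) (fun h Q => Q)).
  move=> x [xs [l ls [lp xl]]].
  have [g gG lg] := ball_net_scaled G2net br0 lp.
  exists g => //; split => //; exists l => //; split => //.
  apply: le_trans lg _; rewrite le_eqVlt; apply/orP; left; apply/eqP.
  by field; rewrite lt0r_neq0.
apply: hcover_seq => g gG; set c := p + _.
(* A point [x] of the region keeps the other obstacles away from [l]. *)
have [[x [[_ xs] [l ls [lc xl]]]]|none] := pselect (exists x,
   obst_far (4 * K + 4) B s x /\ exists2 l, l \in s &
     `|l.1 - c| <= r / 4 /\ `|x - l.1| <= th * r); last first.
  by apply: hcover_set0 => x xP; apply: none; exists x.
have thr0 : 0 < th * r by rewrite mulr_gt0.
apply: hcover_sub (annulus_cover l.1 rC K1 G1net (s0 _ ls) thr0) => //.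
  move=> h [h0 hy]; split => // y yh o os.
  have [->|ol] := eqVneq o l; first by case: (hy y yh).
  have [_ yl] := hy y yh.
  have xo := xs _ os.
  have [lo _] := sep _ _ os ls ol.
  have o0 := s0 _ os.
  (* The choice of [th] puts [y] within [(3 * K + 2) * th * r = r / 4] of [x], which is less than
     half the distance from [x] to [o.1]; the other half is at least the radius of [o]. *)
  have h1 : o.2 * 2 <= `|x - o.1| by nra.
  have h2 := ler_distD l.1 x o.1; have h3 := ler_distD x o.1 l.1.
  have h4 := ler_distD y x o.1; have h5 := ler_distD l.1 x y.
  rewrite (distrC o.1 x) in h3; rewrite (distrC l.1 y) in h5.
  nra.
move=> z [[_ zs] [l' l's [l'c zl']]].
have [->|ll'] := eqVneq l l'; first by split => //; exact: zs.
have [? _] := sep _ _ ls l's ll'.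
have := ler_distD c l.1 l'.1; rewrite (distrC c l'.1); lra.
Qed.

(** Induction on the number of obstacles, one merge per step. Points at distance at least
    [4 * r * a] from the merged obstacle are left to the induction hypothesis. The others are
    covered by annuli if within [th * r] of an obstacle, and by homothets of ratio [sg]
    otherwise. *)
Lemma obstacle_cover (R : realType) (d : nat) (K : R) (C : set 'rV[R]_d)
    (G1 G2 G3 : seq 'rV[R]_d) (B r th e : R) (s : seq ('rV[R]_d * R)) :
  let a := 4 * K + 4 in
  round_body K C -> 1 <= K -> ball_net (4 * K)^-1 G1 ->
  th * (4 * (3 * K + 2)) = 1 ->
  ball_net (4 * (4 * a + 1))^-1 G2 -> 0 < e -> e * (4 * (4 * a) * (K + 1)) = th ->
  ball_net e G3 -> 0 < r -> 0 <= B ->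
  (forall o, o \in s -> 0 < o.2) -> s != [::] -> obst_sep r s ->
  hcover C (obst_free C s) ((size G2 * size G1 + size G3 + size G1) * size s)
    (obst_far a B s).
Proof.
move=> a rC K1 G1net thE G2net e0 eE G3net + B0.
have th0 : 0 < th by nra.
have a8 : 8 <= a by rewrite /a; lra.
have [n] := ubnP (size s); elim: n s r => // n IH s r sn r0 s0 ne sep.
have [[i [j [si sj ij]]]|single] := pselect (exists i j, [/\ i \in s, j \in s & i != j]);
  last first.
  (* With only one obstacle, a single annulus with large outer radius reaches the whole region. *)
  case: s sn s0 ne sep single => [//|o s] sn s0 _ sep single.
  have R0 : 0 < B + `|o.1| + 1 by rewrite ltr_wpDl // addr_ge0.
  have oE o' : o' \in o :: s -> o' = o.
    move=> o's; apply/eqP; apply: contra_notT single => o'o.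
    by exists o', o; split => //; exact: mem_head.
  apply: hcover_sub (annulus_cover o.1 rC K1 G1net (s0 _ (mem_head _ _)) R0).
  - by rewrite -[leqLHS]muln1 leq_mul // leq_addl.
  - by move=> h [h0 hy]; split => // y /hy[yo _] o' /oE ->.
  - move=> x [xB xs]; split; first by apply: xs; exact: mem_head.
    by have := ler_normB x o.1; lra.
have [i' [j' [{si}si {sj}sj {ij}ij minij]]] := closest_pair fst si sj ij.
move: i' j' si sj ij minij => {i j} i j si sj ij minij.
set r1 := `|i.1 - j.1| in minij.
have rr1 : r <= r1 by case: (sep i j).
(* If the smallest distance [r1] is at least [2 * r], the scale is raised to [r1]; thereafter [r]
   and [r1] are comparable. *)
wlog dij : r r0 sep rr1 / r1 < 2 * r => [wl|].
  have [|rr] := ltP r1 (2 * r); first exact: (wl r).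
  by apply: (wl r1) => //; [lra|apply: (obst_sep_double sep) => //; lra|lra].
have sz := obst_merge_size r0 si sj ij dij.
have IHm : hcover C (obst_free C s) ((size G2 * size G1 + size G3 + size G1) *
    size (obst_merge r s i)) (obst_far a B (obst_merge r s i)).
  apply: (@hcover_sub _ _ _ (obst_free C (obst_merge r s i))) (IH _ r _ _ _ _ _) => //.
  - by move=> h; exact: (obst_merge_free r0 sep si sj ij dij).
  - exact: leq_trans sz sn.
  - move=> o; rewrite inE mem_filter => /predU1P[-> /=|/andP[_ /s0 //]]; lra.
  - exact: obst_merge_sep.
(* A point within [4 * a * r] of [i.1] and within [th * r <= r] of [l.1] forces [l.1] to be within
   [(4 * a + 1) * r] of [i.1]. *)
have b0 : 0 < 4 * a + 1 by lra.
have near := obst_annuli_cover B i.1 rC K1 G1net G2net r0 th0 thE b0 s0 sep.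
(* This is the mesh of [G3] scaled by [4 * a * r]. A homothet of ratio [sg] about a net point stays
   within [sg * (K + 1) = th * r / 4] of any point [x] it has to cover, hence off the obstacles. *)
pose sg := 4 * a * r * e.
have sgE : sg * (4 * (K + 1)) = th * r by rewrite /sg -eE; ring.
have sg0 : 0 < sg by rewrite /sg !mulr_gt0 //; lra.
have mid : hcover C (obst_free C s) (size G3) [set x | obst_far a B s x /\
    `|x - i.1| <= 4 * a * r /\ forall l, l \in s -> th * r < `|x - l.1|].
  rewrite -[size G3]muln1.
  have ar0 : 0 < 4 * a * r by rewrite !mulr_gt0 //; lra.
  apply: (@hcover_sub _ _ _ (obst_free C s) _ _ _ [set x | exists2 g, g \in G3 &
     `|x - (i.1 + (4 * a * r) *: g)| <= sg /\ obst_far a B s x /\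
     forall l, l \in s -> th * r < `|x - l.1|] _ (leqnn _) (fun h Q => Q)).
    move=> x [xs [xi xl]].
    by have [g gG xg] := ball_net_scaled G3net ar0 xi; exists g.
  apply: hcover_seq => g gG; set c := i.1 + _.
  have inC x : `|x - c| <= sg -> homothet C sg c x.
    move=> xc; apply/homothetP => //; case: rC => _ C1 _; apply: C1.
    by rewrite normrZ gtr0_norm ?invr_gt0 // mulrC ler_pdivrMr // mul1r.
  have [[x [xc [[_ xs] xl]]]|none] := pselect (exists x,
      `|x - c| <= sg /\ obst_far a B s x /\
      forall l, l \in s -> th * r < `|x - l.1|); last first.
    by apply: hcover_set0 => x xP; apply: none; exists x.
  apply: (@hcover1 _ _ _ _ _ c sg); last by move=> z [zc _]; exact: inC.
  split=> // y [z Cz /= <-] o os.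
  have zK : `|sg *: z| <= sg * K.
    by rewrite normrZ gtr0_norm // ler_pM2l //; case: rC => _ _; apply.
  have h1 : `|x - (sg *: z + c)| <= `|x - c| + `|sg *: z|.
    have -> : x - (sg *: z + c) = (x - c) - sg *: z.
      by apply/rowP => k; rewrite !mxE; ring.
    exact: ler_normB.
  have h2 := ler_distD (sg *: z + c) x o.1.
  have h3 := xs _ os; have h4 := xl _ os; have o0 := s0 _ os.
  have h5 : o.2 * 2 <= `|x - o.1| by nra.
  nra.
apply: hcover_sub (hcoverU IHm (hcoverU near mid)) => //.
  set N := (_ + _ + _)%N; apply: (@leq_trans (N * (size (obst_merge r s i)).+1)).
    by rewrite mulnS addnC leq_add2r /N leq_addr.
  by rewrite leq_mul2l sz orbT.
move=> x [xB xs].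
have [xi|xi] := ltP `|x - i.1| (4 * r * a); last first.
  left; split => // o; rewrite inE mem_filter => /predU1P[-> //|/andP[_ /xs //]].
right; have [[l ls xl]|none] := pselect (exists2 l, l \in s & `|x - l.1| <= th * r).
  left; split => //; exists l => //; split => //.
  have := ler_distD x l.1 i.1; rewrite (distrC l.1 x).
  have th1 : th <= 1 by nra.
  have : th * r <= r by nra.
  nra.
right; split => //; split; first by lra.
by move=> l ls; rewrite ltNge; apply/negP => xl; apply: none; exists l.
Qed.

Lemma seq_separated (R : realType) (d : nat) (P : seq 'rV[R]_d) :
  exists2 r : R, 0 < r &
    forall p q, p \in P -> q \in P -> p != q -> r <= `|p - q|.
Proof.
have [[p [q [pP qP pq]]]|none] :=
  pselect (exists p q, [/\ p \in P, q \in P & p != q]); last first.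
  by exists 1 => // p q pP qP pq; exfalso; apply: none; exists p, q.
have [p' [q' [_ _ pq' minpq]]] := closest_pair id pP qP pq.
by exists `|p' - q'| => //; rewrite normr_gt0 subr_eq0.
Qed.

(** The points become balls of a common radius [rho]. Outside their dilates by [a] the obstacle
    cover applies; each dilate is covered by one homothet of ratio [rho * a]. *)
Lemma point_avoiding_cover (R : realType) (d : nat) (K : R) : 1 <= K ->
  exists N : nat, forall (C : set 'rV[R]_d) (P : seq 'rV[R]_d) (dl B : R),
    round_body K C -> P != [::] -> 0 < dl -> 0 <= B ->
    hcover C (fun h => 0 < h.2 /\
        (h.2 <= dl \/ forall p, p \in P -> ~ homothet C h.2 h.1 p))
      (N * size P) [set x | `|x| <= B].
Proof.
move=> K1; set a := 4 * K + 4; have a8 : 8 <= a by rewrite /a; lra.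
pose th := (4 * (3 * K + 2))^-1; pose e := th / (4 * (4 * a) * (K + 1)).
have thE : th * (4 * (3 * K + 2)) = 1 by rewrite mulVf //; lra.
have th0 : 0 < th by rewrite invr_gt0; lra.
have k0 : 0 < 4 * (4 * a) * (K + 1) by rewrite !mulr_gt0 //; lra.
have eE : e * (4 * (4 * a) * (K + 1)) = th by rewrite divfK // lt0r_neq0.
have e0 : 0 < e by rewrite divr_gt0.
have [|G1 G1net] := @ball_net_exists R d (4 * K)^-1; first by rewrite invr_gt0; lra.
have [|G2 G2net] := @ball_net_exists R d (4 * (4 * a + 1))^-1; first by rewrite invr_gt0; lra.
have [G3 G3net] := @ball_net_exists R d e e0.
exists ((size G2 * size G1 + size G3 + size G1) + 1)%N.
move=> C P dl B rC P0 dl0 B0.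
have [r r0 rP] := seq_separated P.
have [rho [rho0 rho1 rho2]] : exists rho, [/\ 0 < rho, rho <= 2 * r & rho * a <= dl].
  have [ra|ra] := lerP (2 * r * a) dl; first by exists (2 * r); split => //; lra.
  have a0 : 0 < a by lra.
  exists (dl / a); split; first exact: divr_gt0.
    by rewrite ler_pdivrMr // ltW.
  by rewrite divfK // lt0r_neq0.
pose s := [seq (p, rho) | p <- P].
have s0 o : o \in s -> 0 < o.2 by move=> /mapP[p _ ->].
have sep : obst_sep r s.
  move=> _ _ /mapP[p pP ->] /mapP[q qP ->] /= pq; split; last by left.
  by apply: rP => //; apply: contraNneq pq => ->.
have sne : s != [::] by rewrite -size_eq0 size_map size_eq0.
have far := obstacle_cover rC K1 G1net thE G2net e0 eE G3net r0 B0 s0 sne sep.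
have near : hcover C (fun h => 0 < h.2 /\ h.2 <= dl) (size P * 1)
    [set x | exists2 p, p \in P & `|x - p| <= rho * a].
  have ra0 : 0 < rho * a by nra.
  apply: hcover_seq => p pP; apply: (@hcover1 _ _ _ _ _ p (rho * a)) => //.
  move=> x xp; apply/homothetP => //; case: rC => _ C1 _; apply: C1.
  by rewrite normrZ gtr0_norm ?invr_gt0 // mulrC ler_pdivrMr // mul1r.
rewrite mulnDl mul1n -[X in (_ + X)%N]muln1.
move: far; rewrite size_map => far; set Q := (Q in hcover C Q).
have farQ : forall h, obst_free C s h -> Q h.
  move=> h [h0 hs]; split => //; right => p pP /hs/(_ (p, rho)).
  by rewrite map_f //= subrr normr0 => /(_ isT); lra.
have nearQ : forall h, 0 < h.2 /\ h.2 <= dl -> Q h by move=> h [h0 hd]; split=> //; left.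
apply: hcover_sub (hcoverU (hcover_sub (leqnn _) farQ (@subset_refl _ _) far)
  (hcover_sub (leqnn _) nearQ (@subset_refl _ _) near)) => //.
move=> x xB; have [|none] := pselect (exists2 p, p \in P & `|x - p| <= rho * a).
  by right.
left; split => // _ /mapP[p pP ->] /=; rewrite leNgt; apply/negP => xp.
by apply: none; exists p => //; exact: ltW.
Qed.

(** * Greedy packings *)

(* Shrinking the larger homothet towards a common point keeps it inside itself,
   and leaves a ball near the smaller homothet. *)
Lemma meeting_homothet_net (R : realType) (d : nat) (K : R) (C : set 'rV[R]_d)
    (G : seq 'rV[R]_d) (a0 a y : 'rV[R]_d) (l0 l : R) :
  round_body K C -> 1 <= K -> ball_net (4 * K)^-1 G -> 0 < l0 -> l0 / 2 <= l ->
  homothet C l0 a0 y -> homothet C l a y ->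
  exists2 g, g \in G & homothet C l a (a0 + (2 * K * l0) *: g).
Proof.
move=> rC K1 Gnet l00 l0l; have l_gt0 : 0 < l by lra.
have [cC C1 CK] := rC.
move=> [c Cc ya0] /(homothetP _ _ _ l_gt0) Cy.
(* Shrinking about [y] by [t] gives a copy of ratio [l0 / 2] centred at [m], which contains the ball
   of radius [l0 / 2] about [m]. That radius is the mesh of the net scaled by [2 * K * l0]. *)
pose t := l0 / 2 / l.
have t0 : 0 < t by rewrite !divr_gt0.
have t1 : t <= 1 by rewrite ler_pdivrMr // mul1r.
pose m := y + t *: (a - y).
have yK : `|y - a| <= l * K.
  have -> : y - a = l *: (l^-1 *: (y - a)).
    by rewrite scalerA mulfV ?scale1r // lt0r_neq0.
  by rewrite normrZ gtr0_norm // ler_pM2l //; exact: CK.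
have ma0 : `|m - a0| <= 2 * K * l0.
  have -> : m - a0 = l0 *: c - t *: (y - a).
    by rewrite /m -ya0; apply/rowP => i; rewrite !mxE; ring.
  apply: le_trans (ler_normB _ _) _.
  rewrite (normrZ l0 c) (normrZ t (y - a)) !gtr0_norm //.
  have h1 : l0 * `|c| <= l0 * K by rewrite ler_pM2l //; exact: CK.
  have h2 : t * `|y - a| <= t * (l * K) by rewrite ler_pM2l.
  have h3 : t * (l * K) = l0 / 2 * K by rewrite /t; field; rewrite lt0r_neq0.
  nra.
have Kl0 : 0 < 2 * K * l0 by rewrite !mulr_gt0 //; lra.
have [g gG mg] := ball_net_scaled Gnet Kl0 ma0.
exists g => //; set p := a0 + _ in mg *.
have pm : `|p - m| <= l0 / 2.
  rewrite distrC (le_trans mg) // le_eqVlt; apply/orP; left; apply/eqP.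
  by field; rewrite lt0r_neq0 //; lra.
apply/homothetP => //.
have Cw : C ((l0 / 2)^-1 *: (p - m)).
  have h0 : 0 < l0 / 2 by lra.
  by apply: C1; rewrite normrZ gtr0_norm ?invr_gt0 // mulrC ler_pdivrMr // mul1r.
have := cC _ _ _ Cw Cy (ltW t0) t1; congr (C _).
apply/rowP => i; rewrite !mxE /t; field.
by rewrite !lt0r_neq0.
Qed.

(** The infimum is positive but may not be attained; any value below twice the infimum will do. *)
Lemma near_smallest_ratio (R : realType) (T : Type) (f : T -> R) (A : T -> Prop)
    (dl : R) : 0 < dl -> (forall h, A h -> dl <= f h) -> (exists h, A h) ->
  exists2 h0, A h0 & forall h, A h -> f h0 / 2 <= f h.
Proof.
move=> dl0 Adl [h Ah]; pose E := [set f h | h in A].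
have lE : has_lbound E by exists dl => _ [h' /Adl ? <-].
have hE : has_inf E by split => //; exists (f h), h.
have dE : dl <= inf E by apply: lb_le_inf; [exists (f h), h|move=> _ [h' /Adl ? <-]].
have [|_ [h0 Ah0 <-] h0E] := @inf_adherent _ E (inf E) _ hE; first by lra.
exists h0 => // h' Ah'; have : inf E <= f h' by apply: ge_inf => //; exists h'.
lra.
Qed.

Definition disjoint_family (R : realType) (d : nat) (C : set 'rV[R]_d)
    (n : nat) (f : nat -> 'rV[R]_d * R) :=
  forall i j, (i < j < n)%N ->
    homothet C (f i).2 (f i).1 `&` homothet C (f j).2 (f j).1 = set0.

Lemma greedy_packing (R : realType) (d : nat) (K : R) (C : set 'rV[R]_d)
    (G : seq 'rV[R]_d) (good : 'rV[R]_d * R -> Prop) (dl : R) (n : nat) :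
  round_body K C -> 1 <= K -> ball_net (4 * K)^-1 G -> 0 < dl ->
  (exists f, (forall i, (i < n)%N -> good (f i)) /\ disjoint_family C n f) \/
  exists2 P, (size P <= size G * n)%N & forall h, good h -> dl <= h.2 ->
    exists2 p, p \in P & homothet C h.2 h.1 p.
Proof.
move=> rC K1 Gnet dl0.
(* Invariant of the greedy choice: a good homothet of ratio at least [dl] is either disjoint from
   all chosen ones, hence still a candidate, or hit by [P]. Once no candidate is left, [P] hits them
   all. *)
suff : (exists f P, [/\ forall i, (i < n)%N -> good (f i), disjoint_family C n f,
      (size P <= size G * n)%N & forall h, good h -> dl <= h.2 ->
        (forall i, (i < n)%N ->
          homothet C (f i).2 (f i).1 `&` homothet C h.2 h.1 = set0) \/
        exists2 p, p \in P & homothet C h.2 h.1 p]) \/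
  exists2 P, (size P <= size G * n)%N & forall h, good h -> dl <= h.2 ->
    exists2 p, p \in P & homothet C h.2 h.1 p.
  by move=> [[f [P [fg fd _ _]]]|?]; [left; exists f|right].
elim: n => [|n [[f [P [fg fd Pn fP]]]|[P Pn Phit]]].
- by left; exists (fun=> (0, 0)), [::]; split => // [i j|h _ _]; [lia|left].
- have [some|none] := pselect (exists h, [/\ good h, dl <= h.2 &
    forall i, (i < n)%N ->
      homothet C (f i).2 (f i).1 `&` homothet C h.2 h.1 = set0]); last first.
    right; exists P; first by rewrite (leq_trans Pn) // leq_mul2l leqnSn orbT.
    move=> h hg hd; case: (fP h hg hd) => // hdis.
    by exfalso; apply: none; exists h.
  have [|h0 [g0 d0 dis0] hmin] := near_smallest_ratio dl0 _ some (f := snd).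
    by move=> h [].
  left; exists (fun i => if i == n then h0 else f i).
  exists ([seq h0.1 + (2 * K * h0.2) *: g | g <- G] ++ P); split.
  - move=> i; rewrite ltnS leq_eqVlt; case: eqP => //= _; exact: fg.
  - move=> i j /andP[ij]; rewrite ltnS leq_eqVlt => /predU1P[jn|jn].
      by rewrite jn eqxx ltn_eqF -?jn //; apply: dis0; rewrite -jn.
    by rewrite !ltn_eqF // ?(ltn_trans ij jn) //; apply: fd; rewrite ij.
  - by rewrite size_cat size_map mulnS leq_add2l.
  - move=> h hg hd; case: (fP h hg hd) => [hdis|[p pP hp]]; last first.
      by right; exists p => //; rewrite mem_cat pP orbT.
    (* A former candidate meeting [h0] has at least half its ratio, so the net placed around [h0]
       hits it. *)
    have [[y [y0 yh]]|dis] := pselect (homothet C h0.2 h0.1 `&` homothet C h.2 h.1 !=set0).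
      have [g gG gh] := meeting_homothet_net rC K1 Gnet (lt_le_trans dl0 d0)
        (hmin h (And3 hg hd hdis)) y0 yh.
      right; exists (h0.1 + (2 * K * h0.2) *: g) => //.
      by rewrite mem_cat; apply/orP; left; apply/mapP; exists g.
    left => i; rewrite ltnS leq_eqVlt => /predU1P[->|i_n].
      by rewrite eqxx; apply/eqP; apply: contra_notT dis => /set0P.
    by rewrite ltn_eqF //; exact: hdis.
- right; exists P => //; by rewrite (leq_trans Pn) // leq_mul2l leqnSn orbT.
Qed.

Lemma packing_or_cover (R : realType) (d : nat) (K : R) : 1 <= K ->
  exists2 N : nat, (0 < N)%N & forall (C : set 'rV[R]_d)
    (good : 'rV[R]_d * R -> Prop) (dl B : R) (n : nat),
    round_body K C -> 0 < dl -> 0 <= B -> (0 < n)%N ->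
    (exists f, (forall i, (i < n)%N -> good (f i)) /\ disjoint_family C n f) \/
    hcover C (fun h => 0 < h.2 /\ (h.2 <= dl \/ ~ good h)) (N * n)
      [set x | `|x| <= B].
Proof.
move=> K1; have [N HN] := @point_avoiding_cover R d K K1.
have [|G Gnet] := @ball_net_exists R d (4 * K)^-1; first by rewrite invr_gt0; lra.
exists (N * (size G + 1)).+1 => // C good dl B n rC dl0 B0 n0.
have [?|[P Pn Phit]] := greedy_packing good n rC K1 Gnet dl0; first by left.
(* The point [0] makes the list nonempty; as [0 < n], its cost fits into the factor [size G + 1]. A
   homothet that avoids [P] and has ratio above [dl] cannot be good. *)
right; apply: hcover_sub (HN C (0 :: P) dl B rC isT dl0 B0) => //.
  apply: (@leq_trans (N * ((size G + 1) * n))); last by rewrite mulnA leq_mul2r leqnSn orbT.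
  by rewrite leq_mul2l mulnDl mul1n /= -addn1 leq_add ?orbT.
move=> h [h0 [hd|hP]]; split => //; first by left.
have [hd|hd] := lerP h.2 dl; [by left|right => hg].
have [p pP hp] := Phit h hg (ltW hd).
by apply: (hP p) => //; rewrite inE pP orbT.
Qed.

(** * Affine normalization of a convex body *)

Lemma segment_closed_average (R : realType) (d : nat) (C : set 'rV[R]_d) (n : nat)
    (u : 'I_n.+1 -> 'rV[R]_d) :
  segment_closed C -> (forall i, C (u i)) -> C (n.+1%:R^-1 *: \sum_i u i).
Proof.
move=> cC; elim: n u => [|n IH] u Cu.
  by rewrite big_ord_recl big_ord0 addr0 invr1 scale1r.
rewrite big_ord_recl /=.
pose t : R := n.+2%:R^-1.
have t0 : 0 <= t by rewrite invr_ge0.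
have t1 : t <= 1 by rewrite invf_le1 ?ltr0n // ler1n.
have := cC _ _ _ (Cu ord0) (IH (fun i => u (lift ord0 i)) (fun i => Cu _)) t0 t1.
congr (C _); rewrite scalerDr scalerA; congr (_ + _ *: _).
have n1 : n.+1%:R != 0 :> R by rewrite pnatr_eq0.
have n2 : n.+2%:R != 0 :> R by rewrite pnatr_eq0.
apply: (mulIf n1); rewrite divfK // /t; apply: (mulIf n2).
by rewrite mulrBl mulrAC mulVf // mul1r -[n.+2%:R]natr1; ring.
Qed.

Lemma det_norm_le (R : realDomainType) (n : nat) (A : 'M[R]_n) (b : R) :
  (forall i j, `|A i j| <= b) -> `|\det A| <= n`!%:R * b ^+ n.
Proof.
move=> Ab; rewrite /determinant (le_trans (ler_norm_sum _ _ _)) //.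
rewrite -perm.card_Sn mulr_natl -sumr_const ler_sum // => s _.
rewrite normrM normrX normrN1 expr1n mul1r normr_prod.
rewrite -[X in b ^+ X]card_ord -prodr_const; apply: ler_prod => i _.
by rewrite normr_ge0 Ab.
Qed.

(** The rows are the edges at [v0], so the absolute value of the determinant is [d!] times the
    volume of the simplex. *)
Definition simplex_mx (R : realType) (d : nat) (v0 : 'rV[R]_d)
    (v : 'I_d -> 'rV[R]_d) : 'M[R]_d :=
  \matrix_(i, j) (v i ord0 j - v0 ord0 j).

Lemma mulmx_simplex (R : realType) (d : nat) (v0 : 'rV[R]_d)
    (v : 'I_d -> 'rV[R]_d) (t : 'rV[R]_d) :
  t *m simplex_mx v0 v = \sum_i t ord0 i *: (v i - v0).
Proof.
by apply/rowP => j; rewrite mxE summxE; apply: eq_bigr => i _; rewrite !mxE.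
Qed.

(* Cramer's rule: barycentric coordinates are ratios of volumes. *)
Lemma det_simplex_replace (R : realType) (d : nat) (v0 : 'rV[R]_d)
    (v : 'I_d -> 'rV[R]_d) (x : 'rV[R]_d) (i : 'I_d) :
  simplex_mx v0 v \in unitmx ->
  \det (simplex_mx v0 (fun k => if k == i then x else v k)) =
  ((x - v0) *m invmx (simplex_mx v0 v)) ord0 i * \det (simplex_mx v0 v).
Proof.
move=> uV; rewrite /invmx uV -scalemxAr mxE.
rewrite mulrAC mulVf ?mul1r; last by move: uV; rewrite unitmxE unitfE.
rewrite (expand_det_row _ i) mxE; apply: eq_bigr => j _.
rewrite !mxE eqxx; congr (_ * (_ * \det _)).
by apply/matrixP => a b; rewrite !mxE eq_sym (negbTE (neq_lift _ _)).
Qed.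

(** Replacing a vertex by [x] multiplies the volume by the absolute value of a coordinate of [x]. If
    the simplex has more than half the supremum of the volumes, that factor is at most 2. *)
Lemma large_simplex (R : realType) (d : nat) (C : set 'rV[R]_d) :
  convex_body C -> exists v0 v, [/\ C v0, forall i, C (v i),
    simplex_mx v0 v \in unitmx &
    forall x i, C x -> `|((x - v0) *m invmx (simplex_mx v0 v)) ord0 i| <= 2].
Proof.
move=> [_ [cC [x0 x0C]]].
have [b bC] : exists b, forall x, C x -> `|x| <= b.
  have [M [_ MC]] := compact_bounded cC.
  by exists (M + 1) => x Cx; apply: (MC (M + 1)) => //; rewrite ltrDl.
pose E := [set t : R | exists v0 v, [/\ C v0, forall i, C (v i) &
  t = `|\det (simplex_mx v0 v)|]].
have [e e0 eE] : exists2 e, 0 < e & E e.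
  move: x0C; rewrite /interior /= => /nbhs_ballP[r /= r0 rC].
  pose v i := x0 + (r / 2) *: (delta_mx ord0 i : 'rV[R]_d).
  have r20 : 0 < r / 2 by rewrite divr_gt0.
  exists ((r / 2) ^+ d); first exact: exprn_gt0.
  exists x0, v; split.
  - by apply: rC; exact: ballxx.
  - move=> i; apply: rC; rewrite -ball_normE /= /v opprD addNKr normrN.
    apply: (@le_lt_trans _ _ (r / 2)); last by lra.
    apply: row_norm_le => [|j]; first exact: ltW.
    rewrite !mxE normrM gtr0_norm // ler_piMr ?(ltW r20) //.
    by case: (_ && _); rewrite ?normr1 ?normr0.
  - have -> : simplex_mx x0 v = (r / 2)%:M.
      apply/matrixP => i j; rewrite !mxE addrAC subrr add0r eqxx eq_sym.
      by case: eqP => _; rewrite /= ?mulr1 ?mulr0.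
    by rewrite det_scalar normrX gtr0_norm.
have hE : has_sup E.
  split; first by exists e.
  exists (d`!%:R * (b + b) ^+ d) => _ [v0 [v [Cv0 Cv ->]]].
  apply: det_norm_le => i j; rewrite mxE.
  apply: le_trans (ler_normB _ _) _; apply: lerD.
    exact: le_trans (row_norm_ge _ _) (bC _ (Cv i)).
  exact: le_trans (row_norm_ge _ _) (bC _ Cv0).
have supE0 : 0 < sup E by apply: lt_le_trans e0 (ub_le_sup (proj2 hE) eE).
have [|_ [v0 [v [Cv0 Cv ->]]] Vsup] := @sup_adherent _ E (sup E / 2) _ hE.
  by rewrite divr_gt0.
have V0 : 0 < `|\det (simplex_mx v0 v)| by lra.
have uV : simplex_mx v0 v \in unitmx by rewrite unitmxE unitfE -normr_gt0.
exists v0, v; split => // x i Cx.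
rewrite -(ler_pM2r V0) -normrM -det_simplex_replace //.
set W := simplex_mx _ _.
have : `|\det W| <= sup E; last by lra.
apply: (ub_le_sup (proj2 hE)); exists v0, (fun k => if k == i then x else v k).
by split => // k; case: eqP.
Qed.

Lemma round_position (R : realType) (d : nat) (C : set 'rV[R]_d) :
  (0 < d)%N -> convex_body C -> exists (M : 'M[R]_d) q,
    M \in unitmx /\ round_body (4 * d%:R + 1) [set y | C (y *m M + q)].
Proof.
move=> d0 bC; have [v0 [v [Cv0 Cv uV tV]]] := large_simplex bC.
have [cC _] := bC.
set V := simplex_mx v0 v in uV tV.
have dR : 0 < d%:R :> R by rewrite ltr0n.
have k0 : 0 < (2 * d%:R)^-1 :> R by rewrite invr_gt0 mulr_gt0.
(* In the simplex coordinates [y] becomes [(y + one) / (2 * d)]. This sends the unit cube to the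
   cube with side from 0 to [1 / d], inside the standard simplex, and turns the bound 2 on
   coordinates into [4 * d + 1]. *)
pose M := (2 * d%:R)^-1 *: V; pose one := const_mx 1 : 'rV[R]_d.
exists M, (one *m M + v0); split.
  by rewrite unitmxE detZ unitrMl -?unitmxE // unitrX // unitfE lt0r_neq0.
have yE y : y *m M + (one *m M + v0) = (2 * d%:R)^-1 *: ((y + one) *m V) + v0.
  by rewrite addrA -mulmxDl scalemxAr.
have oneE i : one ord0 i = 1 by rewrite mxE.
split.
- move=> x y t Cx Cy t0 t1 /=; have := cC _ _ _ Cx Cy t0 t1; congr (C _).
  rewrite mulmxDl -!scalemxAl; set a := x *m M; set b := y *m M; set c := one *m M + v0.
  by apply/rowP => i; rewrite !mxE; ring.
- move=> y y1 /=; rewrite yE mulmx_simplex.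
  case: d d0 C {bC} cC v0 v Cv0 Cv V uV tV dR k0 M one yE oneE y y1 => // d _ C cC v0 v Cv0 Cv
    _ _ _ dR k0 _ one _ oneE y y1.
  (* The image of [y] is the average of the points dividing the segments from [v0] to [v i] in
     proportion [w i]. *)
  pose w i := (1 + y ord0 i) / 2.
  have w01 i : 0 <= w i /\ w i <= 1.
    have := le_trans (row_norm_ge y i) y1; rewrite ler_norml /w => /andP[? ?].
    by split; lra.
  have Cu i : C (w i *: v i + (1 - w i) *: v0) by apply: cC => //; case: (w01 i).
  have := segment_closed_average cC Cu; congr (C _).
  have v0E : d.+1%:R^-1 *: \sum_(i < d.+1) v0 = v0.
    by rewrite sumr_const card_ord -[v0 *+ _]scaler_nat scalerA mulVf ?scale1r // lt0r_neq0.
  rewrite -[X in _ = _ + X]v0E invfM [2^-1 * _]mulrC -scalerA -scalerDr.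
  congr (_ *: _).
  rewrite scaler_sumr -big_split /=; apply: eq_bigr => i _.
  by apply/rowP => j; rewrite !mxE oneE /w; field.
- move=> y /=; rewrite yE => Cy.
  apply: row_norm_le => [|i]; first by lra.
  have := tV _ i Cy; rewrite addrK -scalemxAl mulmxK // !mxE normrM gtr0_norm //.
  rewrite mulrC ler_pdivrMr ?mulr_gt0 // => h.
  have := ler_normB (y ord0 i + 1) 1; rewrite addrK normr1; lra.
Qed.

Lemma mulmx_bounded (R : realType) (d : nat) (A : 'M[R]_d) (B : R) : 0 <= B ->
  exists2 b, 0 <= b & forall x : 'rV[R]_d, `|x| <= B -> `|x *m A| <= b.
Proof.
move=> B0; exists (B * \sum_j \sum_k `|A j k|).
  by rewrite mulr_ge0 // sumr_ge0 // => j _; rewrite sumr_ge0.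
move=> x xB; apply: row_norm_le => [|k].
  by rewrite mulr_ge0 // sumr_ge0 // => j _; rewrite sumr_ge0.
rewrite mxE mulr_sumr (le_trans (ler_norm_sum _ _ _)) //; apply: ler_sum => j _.
rewrite normrM ler_pM //; first exact: le_trans (row_norm_ge _ _) xB.
by rewrite (bigD1 k) //= lerDl sumr_ge0.
Qed.

Lemma homothet_preimage (R : realType) (d : nat) (C : set 'rV[R]_d)
    (M : 'M[R]_d) (q a x : 'rV[R]_d) (l : R) : M \in unitmx -> 0 < l ->
  homothet C l (a *m M - l *: q) x <->
  homothet [set y | C (y *m M + q)] l a (x *m invmx M).
Proof.
move=> uM l0; rewrite !homothetP //=.
have -> // : l^-1 *: (x - (a *m M - l *: q)) = (l^-1 *: (x *m invmx M - a)) *m M + q.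
rewrite -scalemxAl mulmxBl mulmxKV //; set b := a *m M.
by apply/rowP => i; rewrite !mxE; field; rewrite lt0r_neq0.
Qed.

(** The predicate [good] is arbitrary so that point counts and measures can share this dichotomy;
    [dl] is to be a ratio below which every homothet has weight at most [k]. *)
Definition packs_or_covers (R : realType) (d : nat) (N : nat) (C : set 'rV[R]_d) :=
  forall (good : 'rV[R]_d * R -> Prop) (dl B : R) (n : nat),
    0 < dl -> 0 <= B -> (0 < n)%N ->
    (exists f, (forall i, (i < n)%N -> 0 < (f i).2 /\ good (f i)) /\
               disjoint_family C n f) \/
    hcover C (fun h => 0 < h.2 /\ (h.2 <= dl \/ ~ good h)) (N * n)
      [set x | `|x| <= B].

Lemma body_packs_or_covers (R : realType) (d : nat) : (0 < d)%N ->
  exists2 N : nat, (0 < N)%N & forall C : set 'rV[R]_d,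
    convex_body C -> packs_or_covers N C.
Proof.
move=> d0; have K1 : 1 <= 4 * d%:R + 1 :> R by rewrite lerDr mulr_ge0.
have [N N0 HN] := @packing_or_cover R d _ K1.
exists N => // C bC good dl B n dl0 B0 n0.
have [M [q [uM rC]]] := round_position d0 bC.
have [b b0 bM] := mulmx_bounded (invmx M) B0.
pose T (h : 'rV[R]_d * R) := (h.1 *m M - h.2 *: q, h.2).
have TP h x : 0 < h.2 -> homothet C (T h).2 (T h).1 x <->
    homothet [set y | C (y *m M + q)] h.2 h.1 (x *m invmx M).
  by move=> h0; exact: homothet_preimage.
have [[f [fg fd]]|[s [sn sQ sB]]] :=
  HN _ (fun h => 0 < h.2 /\ good (T h)) dl b n rC dl0 b0 n0.
  left; exists (T \o f); split; first by move=> i /fg[].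
  move=> i j ijn; have /andP[ij jn] := ijn.
  have [fi _] := fg i (ltn_trans ij jn); have [fj _] := fg j jn.
  apply/seteqP; split => // x [/(TP _ _ fi) xi /(TP _ _ fj) xj].
  by have : set0 (x *m invmx M) by rewrite -(fd _ _ ijn).
right; exists (map T s); split; first by rewrite size_map.
  move=> _ /mapP[h hs ->]; have [h0 hQ] := sQ _ hs; split => //.
  by case: hQ => [|ng]; [left|right => g; exact: ng].
move=> x /bM /sB[h hs hx]; exists (T h); first exact: map_f.
by apply/TP => //; case: (sQ _ hs).
Qed.

(** * Finite point sets *)

Lemma packing_nat_of_ratio (R : realType) (N : nat) (k W : R) :
  (0 < N)%N -> 0 < k -> N%:R * k < W ->
  exists2 n : nat, (0 < n)%N & (N * n)%:R * k < W /\ (2 * N%:R)^-1 * W / k <= n%:R.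
Proof.
move=> N0 k0 NkW.
have NR : 0 < N%:R :> R by rewrite ltr0n.
have Nk0 : 0 < N%:R * k by rewrite mulr_gt0.
pose x := W / (N%:R * k).
have Wx : W = x * (N%:R * k) by rewrite divfK // lt0r_neq0.
have x1 : 1 < x by rewrite ltr_pdivlMr // mul1r.
have ex : exists m, x <= m%:R.
  exists (Num.bound x); apply: ltW; apply: archi_boundP; lra.
(* The witness is one less than the ceiling of [x], so [N * n * k] stays strictly below [W]; since
   [x > 1] it is positive and at least [x / 2]. *)
case: (ex_minnP ex) => -[|[|n]] xn minn; [by lra|by lra|].
have nx : n.+1%:R < x by rewrite ltNge; apply/negP => /minn; rewrite ltnn.
exists n.+1 => //; split.
  by rewrite Wx natrM mulrAC mulrC ltr_pM2r.
have -> : (2 * N%:R)^-1 * W / k = x / 2.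
  by rewrite Wx; field; rewrite !lt0r_neq0.
move: xn; rewrite -natr1 => xn; have : 1 <= n.+1%:R :> R by rewrite ler1n.
lra.
Qed.

Lemma packing_g_ge (R : realType) (d : nat) (P : set 'rV[R]_d -> Prop) (N : nat)
    (k W : R) : (0 < N)%N -> 0 < k -> packing P 1 ->
  (forall n, (0 < n)%N -> (N * n)%:R * k < W -> packing P n) ->
  g_ge P ((2 * N%:R)^-1 * W / k).
Proof.
move=> N0 k0 P1 Pn; have [W1|W1] := ltP (N%:R * k) W.
  have [n n0 [nW Wn]] := packing_nat_of_ratio N0 k0 W1.
  by exists n; split => //; exact: Pn.
(* Here [W <= N * k], so the required bound is at most [1/2] and one homothet is enough. *)
exists 1%N; split => //.
have NR : 0 < N%:R :> R by rewrite ltr0n.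
rewrite ler_pdivrMr // mul1r ler_pdivrMl ?mulr_gt0 //; nra.
Qed.

Lemma family_packing (R : realType) (d : nat) (C : set 'rV[R]_d)
    (P : set 'rV[R]_d -> Prop) (n : nat) f :
  (forall i, (i < n)%N -> P (homothet C (f i).2 (f i).1)) ->
  disjoint_family C n f -> packing P n.
Proof.
move=> fP fd; exists (fun i => homothet C (f i).2 (f i).1); split=> [i|i j ij].
  by apply: fP.
apply/seteqP; split => // y [/interior_subset yi /interior_subset yj].
have [lt_ij|lt_ji|/val_inj eq_ij] := ltngtP i j; last by rewrite eq_ij eqxx in ij.
- by have : set0 y by rewrite -(fd i j) ?lt_ij ?ltn_ord.
- by have : set0 y by rewrite -(fd j i) ?lt_ji ?ltn_ord.
Qed.

Lemma body_bounded (R : realType) (d : nat) (C : set 'rV[R]_d) :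
  convex_body C -> exists2 b, 0 < b & forall x, C x -> `|x| <= b.
Proof.
move=> [_ [cC _]]; have [M [_ MC]] := compact_bounded cC.
exists (`|M| + 1) => [|x Cx]; first by rewrite ltr_wpDl.
by apply: (MC (`|M| + 1)) => //; have := ler_norm M; lra.
Qed.

Lemma body_homothet_large (R : realType) (d : nat) (C : set 'rV[R]_d) (B : R) :
  convex_body C -> 0 <= B ->
  exists a l, 0 < l /\ forall x, `|x| <= B -> homothet C l a x.
Proof.
move=> [_ [_ [x0]]] + B0; rewrite /interior /= => /nbhs_ballP[r /= r0 rC].
have B1 : 0 < B + 1 by lra.
have l0 : 0 < (B + 1) / r by rewrite divr_gt0.
exists (- ((B + 1) / r *: x0)), ((B + 1) / r); split => // x xB.
apply/homothetP => //; apply: rC; rewrite -ball_normE /= opprK scalerDr scalerA.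
rewrite mulVf ?lt0r_neq0 // scale1r [_ + x0]addrC opprD addNKr normrN normrZ.
by rewrite gtr0_norm ?invr_gt0 // mulrC ltr_pdivrMr // mulrC divfK ?lt0r_neq0 //; lra.
Qed.

Lemma homothet_diam (R : realType) (d : nat) (C : set 'rV[R]_d) (b l : R)
    (a x y : 'rV[R]_d) : (forall x, C x -> `|x| <= b) -> 0 < l ->
  homothet C l a x -> homothet C l a y -> `|x - y| <= l * (2 * b).
Proof.
move=> bC l0 [x' Cx <-] [y' Cy <-].
have -> : l *: x' + a - (l *: y' + a) = l *: (x' - y').
  by apply/rowP => i; rewrite !mxE; ring.
rewrite normrZ gtr0_norm // ler_pM2l //.
have := ler_normB x' y'; have := bC _ Cx; have := bC _ Cy; lra.
Qed.

Lemma npts_count (R : realType) (d : nat) (S : {fset 'rV[R]_d}) A :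
  npts S A = (\sum_(p <- S) (p \in A))%N.
Proof.
transitivity (count (fun p => p \in A) S); last first.
  by rewrite -sum1_count big_mkcond; apply: eq_bigr => p _; case: (p \in A).
rewrite /npts -size_filter.
apply: perm_size; apply: uniq_perm; first exact: fset_uniq.
  by rewrite filter_uniq // fset_uniq.
by move=> p; rewrite mem_filter !inE andbC.
Qed.

Lemma npts_cover (R : realType) (d : nat) (C : set 'rV[R]_d)
    (S : {fset 'rV[R]_d}) (s : seq ('rV[R]_d * R)) (k : nat) :
  (forall x, x \in S -> exists2 h, h \in s & homothet C h.2 h.1 x) ->
  (forall h, h \in s -> (npts S (homothet C h.2 h.1) <= k)%N) ->
  (#|` S | <= size s * k)%N.
Proof.
move=> sS sk.
have : (\sum_(p <- S) 1 <= \sum_(p <- S) \sum_(h <- s) (p \in homothet C h.2 h.1))%N.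
  rewrite big_seq [leqRHS]big_seq; apply: leq_sum => p pS.
  have [h hs ph] := sS _ pS; rewrite (big_rem h) //=.
  by move/mem_set: ph => ->.
rewrite sum1_size => /leq_trans; apply.
rewrite exchange_big /= -sum1_size big_distrl /= big_seq [leqRHS]big_seq.
by apply: leq_sum => h hs; rewrite mul1n -npts_count; exact: sk.
Qed.

Lemma npts_small (R : realType) (d : nat) (C : set 'rV[R]_d)
    (S : {fset 'rV[R]_d}) : convex_body C ->
  exists2 dl : R, 0 < dl & forall h, 0 < h.2 -> h.2 <= dl ->
    (npts S (homothet C h.2 h.1) <= 1)%N.
Proof.
move=> bC; have [b b0 Cb] := body_bounded bC.
have [r r0 rS] := seq_separated (enum_fset S).
have b40 : 0 < 4 * b by lra.
(* Such a homothet has diameter at most [r / 2], less than the distance between two points of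
   [S]. *)
exists (r / (4 * b)); first exact: divr_gt0.
move=> h h0; rewrite ler_pdivlMr // => hr; rewrite /npts; set X := [fset _ in _ | _]%fset.
have [->|[x xX]] := fset_0Vmem X; first by rewrite cardfs0.
apply: leq_trans (_ : #|` [fset x]%fset | <= 1)%N; last by rewrite cardfs1.
apply: fsubset_leq_card; apply/fsubsetP => y yX; rewrite in_fset1.
move: xX yX; rewrite !inE => /andP[xS /set_mem xh] /andP[yS /set_mem yh].
apply: contraT => yx; have := rS _ _ yS xS yx.
by have := homothet_diam Cb h0 yh xh; lra.
Qed.

Lemma points_packing (R : realType) (d : nat) (N : nat) (C : set 'rV[R]_d)
    (k : nat) (S : {fset 'rV[R]_d}) :
  (0 < N)%N ->
  packs_or_covers N C ->
  convex_body C -> (0 < k)%N -> (k <= #|` S |)%N ->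
  g_ge (kplus_pts C k S) ((2 * N%:R)^-1 * #|` S |%:R / k%:R).
Proof.
move=> N0 HN bC k0 kS.
have [B B0 BS] : exists2 B : R, 0 <= B & forall x, x \in S -> `|x| <= B.
  exists (\sum_(x <- S) `|x|); first by rewrite sumr_ge0.
  by move=> x xS; rewrite (big_rem x) //= lerDl sumr_ge0.
have [dl dl0 dlS] := npts_small S bC.
apply: packing_g_ge => //; first by rewrite ltr0n.
  have [a [l [l0 al]]] := body_homothet_large bC B0.
  apply: (@family_packing _ _ C _ _ (fun=> (a, l))); last by move=> i j ij; exfalso; lia.
  move=> _ _ /=; split; first by exists l, a.
  apply: leq_trans kS _; rewrite npts_count -sum1_size big_seq [leqRHS]big_seq.
  by apply: leq_sum => x xS; rewrite mem_set //; apply/al/BS.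
move=> n n0; rewrite -natrM ltr_nat => nS.
have [[f [fg fd]]|[s [sn sQ sB]]] :=
  HN (fun h => (k <= npts S (homothet C h.2 h.1))%N) dl B n dl0 B0 n0.
  apply: (family_packing _ fd) => i /fg[f0 fk]; split => //.
  by exists (f i).2, (f i).1.
(* A cover by [N * n] homothets, each with at most [k] points, would give [#|S| <= N * n * k]. *)
exfalso; move: nS; apply/negP; rewrite -leqNgt.
apply: (@leq_trans (size s * k)); last by rewrite leq_mul2r sn orbT.
apply: (@npts_cover _ _ C); first by move=> x /BS/sB.
move=> h /sQ[h0 [hd|/negP]]; last by rewrite -ltnNge => /ltnW.
exact: leq_trans (dlS _ h0 hd) k0.
Qed.

(** * Nice measures *)

Lemma open_borel (R : realType) (d : nat) (A : set 'rV[R]_d) :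
  open A -> measurable (A : set (BorelRd R d)).
Proof. by move=> oA; apply: sub_sigma_algebra. Qed.

Lemma closed_borel (R : realType) (d : nat) (A : set 'rV[R]_d) :
  closed A -> measurable (A : set (BorelRd R d)).
Proof.
move=> cA; rewrite -[A]setCK; apply: measurableC.
by apply: open_borel; exact: closed_openC.
Qed.

Lemma homothet_closed (R : realType) (d : nat) (C : set 'rV[R]_d) l a :
  convex_body C -> closed (homothet C l a).
Proof.
move=> [_ [cC _]]; apply: compact_closed; first exact: norm_hausdorff.
apply: continuous_compact => //; apply: continuous_subspaceT => x.
by apply: continuousD; [exact: scaler_continuous|exact: cst_continuous].
Qed.

Lemma bdry_borel (R : realType) (d : nat) (A : set 'rV[R]_d) :
  measurable (bdry A : set (BorelRd R d)).
Proof.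
apply: measurableD; first by apply: closed_borel; exact: closed_closure.
by apply: open_borel; exact: open_interior.
Qed.

Lemma borel_le (R : realType) (d : nat)
    (mu : {measure set (BorelRd R d) -> \bar R}) (A B : set (BorelRd R d)) :
  measurable A -> measurable B -> A `<=` B -> (mu A <= mu B)%E.
Proof. by move=> mA mB AB; apply: le_measure; rewrite ?inE. Qed.

(** Translate [C] so that a point maximizing one coordinate lands on [x]. A measure vanishing on
    boundaries of homothets therefore has no atoms. *)
Lemma point_in_bdry (R : realType) (d : nat) (C : set 'rV[R]_d) (x : 'rV[R]_d) :
  (0 < d)%N -> convex_body C -> exists H, is_homothet C H /\ bdry H x.
Proof.
move=> d0 [_ [cC [x0 x0C]]]; pose i0 := Ordinal d0.
have [||c] := @EVT_max_rV R d (fun y => y ord0 i0) C _ cC.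
- by exists x0; exact: interior_subset.
- by apply: continuous_subspaceT => y; exact: coord_continuous.
rewrite inE => Cc cmax; exists (homothet C 1 (x - c)); split; first by exists 1, (x - c).
split.
  by apply: subset_closure; exists c => //; rewrite scale1r addrC subrK.
rewrite /interior /= => /nbhs_ballP[r /= r0 rH].
pose y := x + (r / 2) *: (delta_mx ord0 i0 : 'rV[R]_d).
have r20 : 0 < r / 2 by rewrite divr_gt0.
have [z Cz zy] : homothet C 1 (x - c) y.
  apply: rH; rewrite -ball_normE /= /y opprD addNKr normrN.
  apply: (@le_lt_trans _ _ (r / 2)); last by lra.
  apply: row_norm_le => [|j]; first exact: ltW.
  rewrite !mxE normrM gtr0_norm // ler_piMr ?(ltW r20) //.
  by case: (_ && _); rewrite ?normr1 ?normr0.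
have zC : z \in C by rewrite inE.
have := cmax z zC.
move: zy => /rowP/(_ i0); rewrite !mxE !eqxx /= mul1r mulr1.
by rewrite (_ : ord0 = 0 :> 'I_1) //; lra.
Qed.

Lemma nice_no_atom (R : realType) (d : nat) (C : set 'rV[R]_d)
    (mu : {measure set (BorelRd R d) -> \bar R}) (x : 'rV[R]_d) :
  (0 < d)%N -> convex_body C -> C_nice C mu -> mu [set x] = 0%E.
Proof.
move=> d0 bC [_ [mu0 _]]; have [H [hH xH]] := point_in_bdry x d0 bC.
apply/eqP; rewrite eq_le measure_ge0 andbT -(mu0 _ hH).
apply: borel_le; last by move=> _ ->.
- apply: closed_borel; apply: accessible_closed_set1; apply: hausdorff_accessible.
  exact: norm_hausdorff.
- exact: bdry_borel.
Qed.

(** Continuity from above of a finite measure along balls shrinking to [x]. *)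
Lemma small_ball_measure (R : realType) (d : nat)
    (mu : {measure set (BorelRd R d) -> \bar R}) (x : 'rV[R]_d) (k : R) :
  (mu setT < +oo)%E -> mu [set x] = 0%E -> 0 < k ->
  exists2 e, 0 < e & (mu (ball x e) < k%:E)%E.
Proof.
move=> fin mux k0.
pose F (n : nat) : set (BorelRd R d) := ball x (n.+1%:R^-1 : R).
have mF n : measurable (F n) by apply: open_borel; exact: ball_open.
have capF : \bigcap_n F n = [set x].
  apply/seteqP; split => [y Fy|_ -> n _]; last first.
    by apply: ballxx; rewrite invr_gt0.
  apply/eqP; rewrite -subr_eq0 -normr_eq0 eq_le normr_ge0 andbT leNgt.
  apply/negP => yx; have [n nyx] := ltr_add_invr yx.
  have : `|x - y| < n.+1%:R^-1 by have := Fy n I; rewrite /F -ball_normE.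
  by rewrite add0r in nyx; rewrite distrC => /(lt_trans nyx); rewrite ltxx.
have mcap : measurable (\bigcap_n F n) by exact: bigcapT_measurable.
have finF : (mu (F 0%N) < +oo)%E.
  by apply: le_lt_trans fin; apply: borel_le => //; exact: measurableT.
have decF : {homo F : n m / (n <= m)%N >-> (m <= n)%O}.
  move=> n m nm; apply/subsetPset; apply: le_ball.
  by rewrite lef_pV2 ?posrE // ler_nat.
have nbh : nbhs (mu (\bigcap_n F n)) [set z : \bar R | (z < k%:E)%E].
  apply: open_nbhs_nbhs; split; first exact: open_ereal_lt_ereal.
  by rewrite /= capF mux lte_fin.
have [n _ Fn] := nonincreasing_cvg_mu finF mF mcap decF nbh.
by exists n.+1%:R^-1; [rewrite invr_gt0|exact: (Fn n (leqnn n))].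
Qed.

(** A Lebesgue number argument: a small enough homothet either misses the compact set carrying the
    measure or lies in one of finitely many balls of measure below [k]. *)
Lemma small_homothet_measure (R : realType) (d : nat) (C : set 'rV[R]_d)
    (mu : {measure set (BorelRd R d) -> \bar R}) (k B : R) :
  convex_body C -> (mu setT < +oo)%E -> (forall x, mu [set x] = 0%E) -> 0 < k ->
  compact [set x : 'rV[R]_d | `|x| <= B] ->
  mu (~` [set x | `|x| <= B]) = 0%E ->
  exists2 dl : R, 0 < dl & forall h, 0 < h.2 -> h.2 <= dl ->
    (mu (homothet C h.2 h.1) <= k%:E)%E.
Proof.
move=> bC fin mux k0 cA muA; have [b b0 Cb] := body_bounded bC.
set A := [set x | _] in cA muA.
have ex x : exists e, 0 < e /\ (mu (ball x e) < k%:E)%E.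
  by have [e ? ?] := small_ball_measure fin (mux x) k0; exists e.
have [e he] := choice ex.
have e0 x : 0 < e x by case: (he x).
have := cA; rewrite compact_cover => /(_ _ A (fun x => ball x (e x / 2))) [].
- by move=> x _; exact: ball_open.
- by move=> x Ax; exists x => //; apply: ballxx; rewrite divr_gt0.
move=> D _ AD.
have [m m0 mD] : exists2 m, 0 < m & forall x, x \in D -> m <= e x.
  have [[x xD]|none] := pselect (exists x, x \in enum_fset D).
    by have [y yD ymin] := seq_argmin e xD; exists (e y).
  by exists 1 => // x xD; exfalso; apply: none; exists x.
have b40 : 0 < 4 * b + 1 by lra.
(* This makes the diameter less than [m / 2]; the covering balls use half of each radius [e x], so
   the other half absorbs the homothet. *)
exists (m / (4 * b + 1)); first exact: divr_gt0.
move=> h h0; rewrite ler_pdivlMr // => hm.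
have mH : measurable (homothet C h.2 h.1 : set (BorelRd R d)).
  by apply: closed_borel; exact: homothet_closed.
have [[y [yH yA]]|dis] := pselect (exists y, homothet C h.2 h.1 y /\ A y).
  have [x /= xD xy] := AD _ yA.
  apply: le_trans (ltW (proj2 (he x))); apply: borel_le => //.
    by apply: open_borel; exact: ball_open.
  move=> z zH; move: xy; rewrite -!ball_normE /= => xy.
  have := homothet_diam Cb h0 yH zH; have := mD _ xD.
  have := ler_distD y x z; nra.
apply: (@le_trans _ _ 0%E); last by rewrite lee_fin ltW.
rewrite -muA; apply: borel_le => //; last by move=> y yH yA; apply: dis; exists y.
by apply: open_borel; apply: closed_openC; exact: (compact_closed (@norm_hausdorff _ _) cA).
Qed.

Lemma measure_cover_le (R : realType) (d : nat) (C : set 'rV[R]_d)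
    (mu : {measure set (BorelRd R d) -> \bar R}) (k : R)
    (s : seq ('rV[R]_d * R)) (A : set (BorelRd R d)) :
  convex_body C -> measurable A ->
  (forall x, A x -> exists2 h, h \in s & homothet C h.2 h.1 x) ->
  (forall h, h \in s -> (mu (homothet C h.2 h.1) <= k%:E)%E) ->
  (mu A <= ((size s)%:R * k)%:E)%E.
Proof.
move=> bC; elim: s A => [|h s IH] A mA sA sk.
  have -> : A = set0 by apply/seteqP; split => // x /sA[].
  by rewrite measure0 mul0r.
have mH : measurable (homothet C h.2 h.1 : set (BorelRd R d)).
  by apply: closed_borel; exact: homothet_closed.
rewrite (measureDI mu mA mH) /= -natr1 mulrDl mul1r EFinD; apply: leeD.
  apply: IH; first exact: measurableD.
    move=> x [/sA[h']]; rewrite inE => /predU1P[-> //|h's h'x _].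
    by exists h'.
  by move=> h' h's; apply: sk; rewrite inE h's orbT.
apply: le_trans (sk _ (mem_head _ _)); apply: borel_le => //.
exact: measurableI.
Qed.

Lemma eball_closed (R : realType) (d : nat) (c : 'rV[R]_d) (r : R) :
  closed (eball c r).
Proof.
have -> : eball c r = (fun y : 'rV[R]_d =>
    \sum_(i < d) (y ord0 i - c ord0 i) ^+ 2) @^-1` [set t | t <= r ^+ 2] by [].
apply: closed_comp; last exact: closed_le.
move=> y _; apply: continuous_big => [|i _ {}y]; first exact: add_continuous.
rewrite /=; under [fun _ => _]eq_fun do rewrite expr2.
have cy : {for y, continuous (fun y : 'rV[R]_d => y ord0 i - c ord0 i)}.
  by apply: continuousB; [exact: coord_continuous|exact: cst_continuous].
exact: (cvgM cy cy).
Qed.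

Lemma eball_norm_le (R : realType) (d : nat) (c x : 'rV[R]_d) (r : R) :
  eball c r x -> `|x| <= `|c| + `|r|.
Proof.
move=> /= xr; rewrite -[x](subrK c) addrC.
apply: le_trans (ler_normD _ _) _; rewrite lerD2l.
apply: row_norm_le => // i; rewrite -ler_sqr ?nnegrE // !real_normK ?num_real //.
apply: le_trans xr; rewrite (bigD1 i) //= !mxE lerDl sumr_ge0 // => j _.
exact: sqr_ge0.
Qed.

Lemma measure_packing (R : realType) (d : nat) (N : nat) (C : set 'rV[R]_d)
    (k : R) (mu : {measure set (BorelRd R d) -> \bar R}) :
  (0 < d)%N -> (0 < N)%N -> packs_or_covers N C ->
  convex_body C -> 0 < k -> C_nice C mu -> (k%:E < mu setT)%E ->
  g_ge (kplus_mu C k mu) ((2 * N%:R)^-1 * fine (mu setT) / k).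
Proof.
move=> d0 N0 HN bC k0 nice kmu.
have [fin [_ [c [r mu_ball]]]] := nice.
(* The Euclidean ball carrying [mu] is enlarged to a ball of the maximum norm about 0, the shape
   that the covers use. *)
pose B := `|c| + `|r|; have B0 : 0 <= B by rewrite addr_ge0.
pose A : set (BorelRd R d) := [set x : 'rV[R]_d | `|x| <= B].
have cA : compact (A : set 'rV[R]_d) by exact: norm_le_compact.
have mA : measurable A.
  by apply: closed_borel; exact: (compact_closed (@norm_hausdorff _ _) cA).
have muA : mu A = mu setT.
  apply/eqP; rewrite eq_le; apply/andP; split.
    by apply: borel_le => //; exact: measurableT.
  rewrite -mu_ball; apply: borel_le => //; last by move=> x /eball_norm_le.
  by apply: closed_borel; exact: eball_closed.
have finmu : mu setT \is a fin_num by rewrite ge0_fin_numE.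
have muAC : mu (~` A) = 0%E.
  have E : mu setT = (mu (~` A) + mu A)%E.
    by rewrite {1}(measureDI mu measurableT mA) setTD setTI.
  rewrite muA in E.
  have finC : mu (~` A) \is a fin_num.
    rewrite ge0_fin_numE //; apply: le_lt_trans fin; apply: borel_le => //.
    exact: measurableC.
  move: E; rewrite -(fineK finmu) -(fineK finC) -EFinD => -[E].
  congr (_%:E); lra.
have [dl dl0 dlS] := small_homothet_measure bC fin
  (fun x => nice_no_atom x d0 bC nice) k0 cA muAC.
apply: packing_g_ge => //.
  have [a [l [l0 al]]] := body_homothet_large bC B0.
  apply: (@family_packing _ _ C _ _ (fun=> (a, l))); last by move=> i j ij; exfalso; lia.
  move=> _ _ /=; split; first by exists l, a.
  apply: le_trans (ltW kmu) _; rewrite -muA; apply: borel_le => //.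
  by apply: closed_borel; exact: homothet_closed.
move=> n n0 nW.
have [[f [fg fd]]|[s [sn sQ sB]]] :=
  HN (fun h => (k%:E <= mu (homothet C h.2 h.1))%E) dl B n dl0 B0 n0.
  apply: (family_packing _ fd) => i /fg[f0 fk]; split => //.
  by exists (f i).2, (f i).1.
exfalso; move: nW; apply/negP; rewrite -leNgt.
have sk h : h \in s -> (mu (homothet C h.2 h.1) <= k%:E)%E.
  move=> /sQ[h0 [hd|/negP]]; first exact: dlS.
  by rewrite -ltNge => /ltW.
have := measure_cover_le bC mA sB sk.
rewrite muA -[X in (X <= _)%E](fineK finmu) lee_fin => /le_trans; apply.
by rewrite ler_pM2r // ler_nat.
Qed.

Theorem mainTheorem3 (R : realType) (d : nat) (d_gt0 : (0 < d)%N) :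
  exists c : R, 0 < c /\
  forall C : set 'rV[R]_d, convex_body C ->
    (forall (k : nat) (S : {fset 'rV[R]_d}),
        (0 < k)%N -> (k <= #|` S |)%N ->
        non_degenerate (k%:R / 2) C S ->
        g_ge (kplus_pts C k S) (c * #|` S |%:R / k%:R)) /\
    (forall (k : R) (mu : {measure set (BorelRd R d) -> \bar R}),
        0 < k -> C_nice C mu -> (k%:E < mu setT)%E ->
        g_ge (kplus_mu C k mu) (c * fine (mu setT) / k)).
Proof.
have [N N0 HN] := @body_packs_or_covers R d d_gt0.
exists (2 * N%:R)^-1; split; first by rewrite invr_gt0 mulr_gt0 // ltr0n.
move=> C bC; split => [k S k0 kS _|k mu k0 nice kmu].
  by apply: points_packing => //; exact: HN.
by apply: measure_packing => //; exact: HN.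
Qed.
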